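(* Let $n\ge 2$ and let $0<\mu\le\lambda_2\le\lambda_3\le\dots\le\lambda_{n-1}\le L$. Consider $f:\mathbb{R}^n\to\mathbb{R}$, $f(x)=\frac12 x^{\top}\mathbf{A}x$ with $\mathbf{A}=\mathrm{diag}(\mu,\lambda_2,\dots,\lambda_{n-1},L)$, and assume $\lambda_2\ge 10\mu$ and $L\ge 100\mu$ (for $n=2$, $\mathbf A=\mathrm{diag}(\mu,L)$ and $\lambda_2=L$). Let $\alpha=\frac1L$ and $\beta\in\left[\left(1-3\sqrt{\mu/L}\right)^2,\left(1-2\sqrt{\mu/L}\right)^2\right]$, and let $x_0=x_1=(1,1,\dots,1)^\top\in\mathbb{R}^n$. Then the iterates $\{\overline{x}_k\}_{k\ge 0}$ generated by the Averaged Heavy-Ball method with stepsize $\alpha$ and momentum parameter $\beta$ started from $x_0,x_1$ satisfy $$\max_{k\ge 0}\|\overline{x}_k\|_\infty\le 2 .$$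
   Context: Averaged Heavy-Ball method (AHB) for a differentiable $f:\mathbb{R}^n\to\mathbb{R}$ with stepsize $\alpha>0$, momentum parameter $\beta\in[0,1]$ and starting points $x_0,x_1\in\mathbb{R}^n$: for $k\ge 1$, $$x_{k+1}=x_k-\alpha\nabla f(x_k)+\beta(x_k-x_{k-1}),$$ and for all $k\ge 0$, $\overline{x}_k=\frac{1}{k+1}\sum_{i=0}^{k}x_i$. Here $\|\cdot\|_\infty$ is the maximum norm on $\mathbb{R}^n$. *)

(* Defs.v *)
From HB Require Import structures.
From mathcomp Require Import all_boot all_order all_algebra.
From mathcomp Require Import all_classical all_reals all_analysis.

Set Implicit Arguments.
Unset Strict Implicit.
Unset Printing Implicit Defensive.

Import Order.TTheory GRing.Theory Num.Theory.
Import numFieldNormedType.Exports.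

Local Open Scope ring_scope.

Section HeavyBall.
Context {R : realType} {n : nat}.

(* ['D_v f x] is total: this is the gradient only where [f] is differentiable. *)
Definition gradient (f : 'cV[R]_n -> R) (x : 'cV[R]_n) : 'cV[R]_n :=
  \col_i 'D_(delta_mx i 0) f x.

Fixpoint heavy_ball (f : 'cV[R]_n -> R) (alpha beta : R) (x0 x1 : 'cV[R]_n)
    (k : nat) {struct k} : 'cV[R]_n :=
  match k with
  | 0 => x0
  | k'.+1 =>
      match k' with
      | 0 => x1
      | k''.+1 =>
          let x := heavy_ball f alpha beta x0 x1 in
          x k' - alpha *: gradient f (x k') + beta *: (x k' - x k'')
      end
  end.

Definition averaged_heavy_ball (f : 'cV[R]_n -> R) (alpha beta : R)
    (x0 x1 : 'cV[R]_n) (k : nat) : 'cV[R]_n :=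
  k.+1%:R^-1 *: \sum_(i < k.+1) heavy_ball f alpha beta x0 x1 i.

Definition quadratic (A : 'M[R]_n) (x : 'cV[R]_n) : R :=
  2^-1 * (x^T *m A *m x) 0 0.

End HeavyBall.

(* The values of [lam] outside 1, ..., n are irrelevant. *)
Definition diag_of {R : realType} (n : nat) (lam : nat -> R) : 'M[R]_n :=
  diag_mx (\row_(i < n) lam i.+1).

(* Main.v *)
Require Import Defs.
From HB Require Import structures.
From mathcomp Require Import all_boot all_order all_algebra.
From mathcomp Require Import all_classical all_reals all_analysis.
From mathcomp Require Import ring lra.

Import Order.TTheory GRing.Theory Num.Theory.
Import numFieldNormedType.Exports.

Local Open Scope ring_scope.

(** The gradient of the quadratic is [A *m x], so each coordinate of the
    heavy-ball iterates evolves on its own: it starts with [u 0 = u 1 = 1] and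
    obeys [u k.+2 = u k.+1 - q * u k.+1 + beta * (u k.+1 - u k)], where
    [mu / L <= q = lam i / L <= 1] and [0 <= beta <= 1].  It is
    enough to bound this scalar recurrence uniformly in [q] and [beta].

    With position [y = u k.+1] and step [d = u k.+1 - u k], the recurrence is a
    discretized damped oscillator.  The usual energy [q y^2 + beta d^2] can
    grow when [beta > 1/2], but a suitable cross term and weight on [d^2] give
    a quadratic form, [momentum_energy], that never increases
    ([momentum_energy_step]) and dominates [3/4 * q (1 + beta) y^2]
    ([momentum_energy_ge]).  Its initial value is [q (1 + beta)], whence
    [u k ^+ 2 <= 4/3]; so every iterate, and therefore every average, has
    coordinates of absolute value at most 2.

    That the maximum over [k] is attained comes from a second fact: summing the
    recurrence telescopes, so the partial sums of [u] stay bounded by [6 / q]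
    ([heavy_ball_recurrence_sum_bounded]).  From some index on, the averages
    thus have norm at most 1, the norm of the average of index 0, and only
    finitely many indices compete for the maximum. *)

(** * The scalar recurrence *)

(** The coefficients come from looking for a form [q y^2 + b y d + a d^2]
    whose variation along one step has neither a [y^2] nor a [y d] term; these
    two equations determine [a] and [b], and the result is multiplied by
    [1 + beta] to clear denominators.  At [beta = 1] it is the invariant
    quadratic form of the undamped recurrence. *)
Definition momentum_energy {R : realFieldType} (q beta y d : R) : R :=
  q * (1 + beta) * y ^+ 2 - 2 * beta * q * y * d
    + (2 - q * (1 - beta)) * d ^+ 2.

(** The loss is nonnegative whenever [0 <= beta <= 1] and [q <= 2], so the form
    is a Lyapunov function. *)
Lemma momentum_energy_step (R : realFieldType) (q beta y d : R) :
  let d' := beta * d - q * y in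
  momentum_energy q beta (y + d') d' =
    momentum_energy q beta y d
      - (1 - beta) * (2 + 2 * beta - q) * d ^+ 2.
Proof. by rewrite /momentum_energy /=; ring. Qed.

Lemma momentum_energy_ge (R : realFieldType) (q beta y d : R) :
  0 <= q <= 1 -> 0 <= beta <= 1 ->
  3 / 4 * (q * (1 + beta) * y ^+ 2) <= momentum_energy q beta y d.
Proof.
move=> /andP[q0 q1] /andP[b0 b1]; rewrite -subr_ge0.
(* The square absorbs the cross term [- 2 * beta * q * y * d]. *)
have -> : momentum_energy q beta y d - 3 / 4 * (q * (1 + beta) * y ^+ 2) =
    q * ((1 - beta) * (y ^+ 2 / 4 + d ^+ 2) + 2 * beta * (y / 2 - d) ^+ 2)
    + 2 * (1 - q) * d ^+ 2.
  by rewrite /momentum_energy; field.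
by repeat first [exact: sqr_ge0 | lra | apply: addr_ge0 | apply: mulr_ge0].
Qed.

Definition heavy_ball_recurrence {R : realFieldType} (q beta : R)
    (u : nat -> R) : Prop :=
  [/\ u 0%N = 1, u 1%N = 1
    & forall k, u k.+2 = u k.+1 - q * u k.+1 + beta * (u k.+1 - u k)].

Lemma heavy_ball_recurrence_bounded {R : realFieldType} (q beta : R)
    (u : nat -> R) :
  0 < q <= 1 -> 0 <= beta <= 1 -> heavy_ball_recurrence q beta u ->
  forall k, `|u k| <= 2.
Proof.
move=> /andP[q0 q1] b01 [u0 u1 uS]; have /andP[b0 b1] := b01.
have E k : momentum_energy q beta (u k.+1) (u k.+1 - u k) <= q * (1 + beta).
  elim: k => [|k]; first by rewrite u0 u1 /momentum_energy; lra.
  apply: le_trans; set d := u k.+1 - u k.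
  have -> : u k.+2 - u k.+1 = beta * d - q * u k.+1 by rewrite uS /d; ring.
  have -> : u k.+2 = u k.+1 + (beta * d - q * u k.+1) by rewrite uS /d; ring.
  rewrite momentum_energy_step gerBl mulr_ge0 ?sqr_ge0// mulr_ge0//; lra.
case=> [|k]; first by rewrite u0 normr1; lra.
rewrite -(ler_pXn2r (n := 2)) ?nnegrE// real_normK ?num_real//.
have q01 : 0 <= q <= 1 by rewrite ltW.
have := le_trans (momentum_energy_ge _ _ _ (u k.+1) (u k.+1 - u k) q01 b01)
  (E k).
rewrite mulrCA -[leRHS]mulr1 ler_pM2l ?mulr_gt0 ?ltr_pwDl//; lra.
Qed.

(** Summing [u k.+2 - u k.+1 = beta * (u k.+1 - u k) - q * u k.+1] makes both
    differences telescope. *)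
Lemma heavy_ball_recurrence_sum {R : realFieldType} (q beta : R)
    (u : nat -> R) (k : nat) :
  heavy_ball_recurrence q beta u ->
  q * \sum_(i < k.+1) u i = 1 - beta + q + beta * u k - u k.+1.
Proof.
move=> [u0 u1 uS]; elim: k => [|k IH]; first by rewrite big_ord1 u0 u1; ring.
by rewrite big_ord_recr /= mulrDr IH uS; ring.
Qed.

(** The right-hand side of [heavy_ball_recurrence_sum] is at most
    [1 + 1 + 2 + 2] in absolute value. *)
Lemma heavy_ball_recurrence_sum_bounded {R : realFieldType} (q beta : R)
    (u : nat -> R) (k : nat) :
  0 < q <= 1 -> 0 <= beta <= 1 -> heavy_ball_recurrence q beta u ->
  q * `|\sum_(i < k.+1) u i| <= 6.
Proof.
move=> q01 b01 hu; have ub := heavy_ball_recurrence_bounded _ _ _ q01 b01 hu.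
have /andP[q0 q1] := q01; have /andP[b0 b1] := b01.
rewrite -[X in X * _](gtr0_norm q0) -normrM.
rewrite (heavy_ball_recurrence_sum _ _ _ _ hu).
have := ub k; have := ub k.+1; rewrite !ler_norml => /andP[? ?] /andP[? ?].
by apply/andP; split; nra.
Qed.

Lemma mean_bounded {R : realFieldType} (u : nat -> R) (c : R) (k : nat) :
  (forall i, `|u i| <= c) ->
  `|k.+1%:R^-1 * \sum_(i < k.+1) u i| <= c.
Proof.
move=> uc; rewrite normrM ger0_norm ?invr_ge0// mulrC ler_pdivrMr ?ltr0Sn//.
apply: le_trans (ler_norm_sum _ _ _) _.
apply: (@le_trans _ _ (\sum_(i < k.+1) c)); first by apply: ler_sum => i _.
by rewrite sumr_const card_ord mulr_natr.
Qed.

Lemma attains_max {R : realFieldType} (u : nat -> R) (N : nat) :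
  (forall k, (N < k)%N -> u k <= u 0%N) ->
  exists K, forall k, u k <= u K.
Proof.
move=> uN.
have [K _ KP] := @arg_maxP _ R _ (@ord0 N) xpredT (fun i : 'I_N.+1 => u i) isT.
exists K => k; have [kN|Nk] := leqP k N.
  exact: (KP (Ordinal (kN : (k < N.+1)%N)) isT).
exact: le_trans (uN k Nk) (KP ord0 isT).
Qed.

(** * From the quadratic to its coordinates *)

(** Along a line the quadratic is a polynomial in [h], whose linear coefficient
    is the directional derivative. *)
Lemma quadratic_line (R : realType) (n : nat) (A : 'M[R]_n)
    (x v : 'cV[R]_n) (h : R) :
  quadratic A (h *: v + x) =
    quadratic A x + h * (2^-1 * ((v^T *m A *m x) 0 0 + (x^T *m A *m v) 0 0))
      + h ^+ 2 * quadratic A v.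
Proof.
rewrite /quadratic.
have -> : (h *: v + x)^T *m A *m (h *: v + x) =
    h ^+ 2 *: (v^T *m A *m v) + h *: (v^T *m A *m x + x^T *m A *m v)
      + x^T *m A *m x.
  have -> : (h *: v + x)^T = h *: v^T + x^T by rewrite linearP.
  rewrite !mulmxDl !mulmxDr -!(scalemxAl, scalemxAr).
  by rewrite scalerA -expr2 scalerDr !addrA.
move: (v^T *m A *m v) (v^T *m A *m x) (x^T *m A *m v) (x^T *m A *m x).
by move=> vv vx xv xx; rewrite !mxE; ring.
Qed.

Lemma gradient_quadratic (R : realType) (n : nat) (A : 'M[R]_n)
    (x : 'cV[R]_n) :
  gradient (quadratic A) x = 2^-1 *: ((A + A^T) *m x).
Proof.
apply/colP => i; rewrite !mxE /derive; set e := delta_mx i 0.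
pose c := 2^-1 * ((e^T *m A *m x) 0 0 + (x^T *m A *m e) 0 0).
have -> : 2^-1 * (\sum_j (A + A^T) i j * x j 0) = c.
  congr (_ * _); rewrite /e trmx_delta.
  have -> : (x^T *m A *m (delta_mx i 0 : 'cV_n)) 0 0 = (A^T *m x) i 0.
    by rewrite -colE !mxE; apply: eq_bigr => j _; rewrite !mxE mulrC.
  rewrite -rowE -row_mul !mxE -big_split /=.
  by apply: eq_bigr => j _; rewrite !mxE mulrDl.
apply: cvg_lim => //.
(* For [h != 0] the difference quotient equals [c + h * quadratic A e]. *)
have : ((fun h : R => c + h * quadratic A e) @ 0^'
          --> c + 0 * quadratic A e)%classic.
  apply: cvgD; first exact: cvg_cst.
  by apply: cvgMl; apply: nbhs_dnbhs.
rewrite mul0r addr0; apply: cvg_trans; apply: near_eq_cvg.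
near=> h.
have h0 : h != 0 by near: h; exact: nbhs_dnbhs_neq.
rewrite /= quadratic_line -/c /GRing.scale /=; field.
exact: h0.
Unshelve. all: by end_near.
Qed.

Lemma gradient_quadratic_sym (R : realType) (n : nat) (A : 'M[R]_n)
    (x : 'cV[R]_n) :
  A^T = A -> gradient (quadratic A) x = A *m x.
Proof.
move=> symA; rewrite gradient_quadratic symA -mulr2n.
by rewrite -[A *+ 2]scaler_nat -scalemxAl scalerA mulVf ?pnatr_eq0// scale1r.
Qed.

Lemma heavy_ballSS (R : realType) (n : nat) (f : 'cV[R]_n -> R)
    (alpha beta : R) (x0 x1 : 'cV[R]_n) (k : nat) :
  let x := heavy_ball f alpha beta x0 x1 in
  x k.+2 = x k.+1 - alpha *: gradient f (x k.+1) + beta *: (x k.+1 - x k).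
Proof. by []. Qed.

Lemma mx_norm_le (R : realFieldType) (m n : nat) (x : 'M[R]_(m, n)) (c : R) :
  0 <= c -> (forall i j, `|x i j| <= c) -> `|x| <= c.
Proof.
move=> c0 xc; rewrite [leLHS]/Num.Def.normr/= mx_normrE.
by apply: bigmax_le => // -[i j] _; exact: xc.
Qed.

Lemma mx_norm_ge (R : realFieldType) (m n : nat) (x : 'M[R]_(m, n)) i j :
  `|x i j| <= `|x|.
Proof.
rewrite [leRHS]/Num.Def.normr/= mx_normrE.
by apply/bigmax_geP; right; exists (i, j).
Qed.

Lemma heavy_ball_diag_recurrence (R : realType) (n : nat) (lam : nat -> R)
    (alpha beta : R) (i : 'I_n) :
  heavy_ball_recurrence (alpha * lam i.+1) beta
    (fun k => heavy_ball (quadratic (diag_of n lam)) alpha beta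
                (const_mx 1) (const_mx 1) k i 0).
Proof.
split; rewrite ?mxE // => k.
rewrite heavy_ballSS gradient_quadratic_sym ?tr_diag_mx// mul_diag_mx.
by rewrite !mxE mulrA.
Qed.

Theorem theorem2p2 (R : realType) (n : nat) (mu L beta : R) (lam : nat -> R)
    (n_ge2 : (2 <= n)%N)
    (mu_gt0 : 0 < mu)
    (lam_first : lam 1%N = mu)
    (lam_last : lam n = L)
    (lam_le : forall i : nat, (1 <= i < n)%N -> lam i <= lam i.+1)
    (lam2_ge : 10 * mu <= lam 2%N)
    (L_ge : 100 * mu <= L)
    (beta_bounds : (1 - 3 * Num.sqrt (mu / L)) ^+ 2 <= beta
                   <= (1 - 2 * Num.sqrt (mu / L)) ^+ 2) :
  let f : 'cV[R]_n -> R := quadratic (diag_of n lam) in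
  let ones : 'cV[R]_n := const_mx 1 in
  let xbar := averaged_heavy_ball f L^-1 beta ones ones in
  exists2 K : nat, (forall k : nat, `|xbar k| <= `|xbar K|) & `|xbar K| <= 2.
Proof.
move=> f ones xbar.
have L_gt0 : 0 < L by lra.
have kappa_gt0 : 0 < mu / L by rewrite divr_gt0.
have b01 : 0 <= beta <= 1.
  case/andP: beta_bounds => lo hi; rewrite (le_trans (sqr_ge0 _) lo) /=.
  have s0 : 0 <= Num.sqrt (mu / L) by exact: sqrtr_ge0.
  have : Num.sqrt (mu / L) ^+ 2 <= 100^-1.
    by rewrite sqr_sqrtr ?(ltW kappa_gt0)// ler_pdivrMr//; lra.
  (* [sqrt (mu / L) <= 1 / 10], so [1 - 2 * sqrt (mu / L)] is in [0, 1]. *)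
  by nra.
have lam_mono i j : (1 <= i <= j)%N -> (j <= n)%N -> lam i <= lam j.
  move=> /andP[i1]; elim: j => [|j IH]; first by rewrite leqn0 => /eqP->.
  rewrite leq_eqVlt => /predU1P[->//|ij] jn.
  by apply: le_trans (IH ij (ltnW jn)) (lam_le _ _); rewrite (leq_trans i1 ij).
have lam_bnd (i : 'I_n) : mu <= lam i.+1 <= L.
  have lt_in := ltn_ord i.
  by rewrite -[mu]lam_first -[L]lam_last !lam_mono ?ltnS ?leqnn ?andbT.
have q_ge (i : 'I_n) : mu / L <= L^-1 * lam i.+1.
  by rewrite mulrC ler_pM2l ?invr_gt0//; case/andP: (lam_bnd i).
have q01 (i : 'I_n) : 0 < L^-1 * lam i.+1 <= 1.
  rewrite (lt_le_trans _ (q_ge i)) ?divr_gt0//= mulrC ler_pdivrMr// mul1r.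
  by case/andP: (lam_bnd i).
pose u (i : 'I_n) k : R := heavy_ball f L^-1 beta ones ones k i 0.
have hu (i : 'I_n) : heavy_ball_recurrence (L^-1 * lam i.+1) beta (u i).
  exact: heavy_ball_diag_recurrence.
have xbarE k i j : xbar k i j = k.+1%:R^-1 * \sum_(m < k.+1) u i m.
  by rewrite ord1 /xbar /averaged_heavy_ball !mxE summxE.
have xbar2 k : `|xbar k| <= 2.
  apply: mx_norm_le => // i j; rewrite xbarE; apply: mean_bounded.
  exact: heavy_ball_recurrence_bounded (q01 i) b01 (hu i).
have xbar0 : 1 <= `|xbar 0%N|.
  have n0 : (0 < n)%N by exact: ltnW.
  apply: le_trans (mx_norm_ge _ _ _ _ (Ordinal n0) 0).
  by rewrite xbarE big_ord1 /u /= mxE invr1 mulr1 normr1.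
(* Beyond index [6 L / mu] the bounded sums are divided by more than
   their bound. *)
have [|K KP] := @attains_max R (fun k => `|xbar k|) (Num.bound (6 / (mu / L))).
  move=> k kN; apply: le_trans xbar0; apply: mx_norm_le => // i j.
  rewrite xbarE normrM ger0_norm ?invr_ge0// mulrC ler_pdivrMr ?ltr0Sn// mul1r.
  apply: (@le_trans _ _ (6 / (mu / L))).
    rewrite ler_pdivlMr// mulrC.
    have := heavy_ball_recurrence_sum_bounded _ _ _ k (q01 i) b01 (hu i).
    apply: le_trans.
    exact: ler_wpM2r.
  apply/ltW; apply: lt_trans (archi_boundP _) _.
    by rewrite divr_ge0// ltW.
  by rewrite ltr_nat ltnW.
by exists K.
Qed.
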